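(* Let $1\le p\le\infty$ and let $T=M_wEM_u$ be a bounded weighted conditional expectation operator on $L^p(\mathcal{F})$. Suppose that $E(uw)$ is bounded away from zero, i.e. there exists $C>0$ such that $\mu(\{x\in X: |E(uw)(x)|\le C\})=0$. Then $\mathcal{R}(T^2)=\mathcal{R}(T^{n+2})$ for all $n\in\mathbb{N}$.
   Context: $(X,\mathcal{F},\mu)$ is a complete $\sigma$-finite measure space and $\mathcal{A}\subseteq\mathcal{F}$ is a $\sigma$-subalgebra such that $(X,\mathcal{A},\mu|_{\mathcal{A}})$ is also $\sigma$-finite. Statements about sets and functions hold up to sets of measure zero. $L^0(\mathcal{F})$ is the set of (classes of) $\mathcal{F}$-measurable complex-valued functions, and $L^p(\mathcal{F})=L^p(X,\mathcal{F},\mu)$. $E=E^{\mathcal{A}}$ is the conditional expectation with respect to $\mathcal{A}$: $E(f)$ is the unique $\mathcal{A}$-measurable function with $\int_A E(f)\,d\mu=\int_A f\,d\mu$ for all $A\in\mathcal{A}$, defined for $f\ge 0$ and for $f\in L^p(\mathcal{F})$, and extended to conditionable functions (those with $E(|f|)<\infty$ a.e.). For $u,w\in L^0(\mathcal{F})$ such that $uf$ is conditionable and $wE(uf)\in L^p(\mathcal{F})$ for all $f\in L^p(\mathcal{F})$, the weighted conditional expectation operator $T=M_wEM_u$ on $L^p(\mathcal{F})$ is $Tf=wE(uf)$; it is assumed to be bounded (then $E(uw)$ is defined and lies in $L^\infty(\mathcal{A})$). $\mathcal{R}(\cdot)$ denotes the range. *)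

(* Defs.v *)
From HB Require Import structures.
From mathcomp Require Import all_boot all_order all_algebra.
From mathcomp Require Import all_classical all_reals all_analysis.
From mathcomp Require Import measurable_realfun.
From mathcomp Require Import complex.

Set Implicit Arguments.
Unset Strict Implicit.
Unset Printing Implicit Defensive.
Import Order.TTheory GRing.Theory Num.Theory.

Local Open Scope classical_set_scope.
Local Open Scope ring_scope.
Local Open Scope complex_scope.

Section ComplexFunctions.
Context (d : measure_display) (X : measurableType d) (R : realType).
Variable mu : {measure set X -> \bar R}.

Definition cmod (f : X -> R[i]) (x : X) : R := ComplexField.Normc.normc (f x).

(* Measurability for the Borel sigma-algebra of R[i], identified with R * R. *)
Definition L0 : set (X -> R[i]) :=
  [set f | measurable_fun [set: X] (fun x => complex.Re (f x)) /\
           measurable_fun [set: X] (fun x => complex.Im (f x))].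

Definition cLnorm (p : \bar R) (f : X -> R[i]) : \bar R :=
  'N[mu]_p[EFin \o cmod f]%E.

Definition Lp (p : \bar R) : set (X -> R[i]) :=
  L0 `&` [set f | (cLnorm p f < +oo)%E].

Definition ae_class (f : X -> R[i]) : set (X -> R[i]) :=
  L0 `&` [set g | ae_eq mu [set: X] f g].

(* The range of the operator on L^p induced by an operator S on
   representatives, as a set of almost-everywhere classes. *)
Definition Lp_range (p : \bar R) (S : (X -> R[i]) -> X -> R[i])
    : set (set (X -> R[i])) :=
  [set ae_class (S f) | f in Lp p].

End ComplexFunctions.

Section ConditionalExpectation.
Context (d : measure_display) (X : measurableType d) (R : realType).
Variables (mu : {measure set X -> \bar R}) (G : set (set X)).

(* [g_sigma_algebraType G] is X with the sigma-algebra generated by G, which is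
   G itself when G is a sigma-algebra. *)
Definition is_condexp (f g : X -> \bar R) : Prop :=
  [/\ forall x, (0 <= g x)%E,
      measurable_fun [set: g_sigma_algebraType G]
        (g : g_sigma_algebraType G -> \bar R) &
      forall A, G A -> (\int[mu]_(x in A) g x = \int[mu]_(x in A) f x)%E].

(* A version of E(f) for f >= 0. When mu is sigma-finite on G and f is
   measurable, one exists (Radon-Nikodym) and any two are almost everywhere
   equal. *)
Definition ge0_condexp (f : X -> \bar R) : X -> \bar R :=
  xget (cst 0%E) [set g | is_condexp f g].

Definition conditionable (f : X -> R[i]) : Prop :=
  {ae mu, forall x, (ge0_condexp (EFin \o cmod f) x < +oo)%E}.

Definition re_condexp (f : X -> R) (x : X) : R :=
  fine (ge0_condexp (EFin \o f)^\+%E x) - fine (ge0_condexp (EFin \o f)^\-%E x).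

(* Meaningful for conditionable f: the four nonnegative conditional
   expectations involved are then almost everywhere finite. *)
Definition condexp (f : X -> R[i]) (x : X) : R[i] :=
  re_condexp (fun y => complex.Re (f y)) x +i*
  re_condexp (fun y => complex.Im (f y)) x.

Definition wce (u w f : X -> R[i]) (x : X) : R[i] :=
  w x * condexp (fun y => u y * f y) x.

Definition bounded_wce (p : \bar R) (u w : X -> R[i]) : Prop :=
  [/\ L0 u, L0 w,
      forall f, Lp mu p f ->
        conditionable (fun x => u x * f x) /\ Lp mu p (wce u w f) &
      exists M : R, forall f, Lp mu p f ->
        (cLnorm mu p (wce u w f) <= M%:E * cLnorm mu p f)%E].

End ConditionalExpectation.

(* Main.v *)
Require Import Defs.
From HB Require Import structures.
From mathcomp Require Import all_boot all_order all_algebra.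
From mathcomp Require Import all_classical all_reals all_analysis.
From mathcomp Require Import measurable_realfun.
From mathcomp Require Import complex.
From mathcomp Require Import ess_sup_inf ring lra.

Import Order.TTheory GRing.Theory Num.Theory.
Local Open Scope classical_set_scope.
Local Open Scope ring_scope.

(** Put [h = E(uw)].  A function of the form [E(uf)] is measurable for the
    sub-sigma-algebra, so it can be pulled out of a conditional expectation:
    [T (T f) = w E(u w E(uf)) = w E(uf) E(uw) = h (T f)] almost everywhere, and
    by iteration [T^(n+1) f = h^n (T f)].  Since [|h| > C > 0] almost
    everywhere, [k = h^-n] is bounded and measurable for the sub-sigma-algebra;
    hence [k f] is in [L^p] with [f], and [T (k f) = k (T f)].  Therefore
    [T^(n+2) (k f) = h^(n+1) k (T f) = h (T f) = T^2 f], so the range of [T^2]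
    is contained in that of [T^(n+2)].  The other inclusion holds because
    [T^(n+2) f = T^2 (T^n f)].

    Two points need real work.  The first is the conditional expectation itself.
    For nonnegative functions, possibly with infinite integral, existence
    ([ge0_condexpP]) comes from Radon-Nikodym on pieces of finite integral,
    uniqueness ([is_condexp_unique]) from a comparison of densities, and the
    pull-out rule ([is_condexpM]) from approximation by simple functions.
    Complex functions are handled by writing their real and imaginary parts as
    differences of nonnegative functions ([ccondexp_unique], [ccondexpM],
    [condexpP]).

    The second is that [E(uw)] makes sense at all: that [E|uw|] is almost
    everywhere finite has to be extracted from [T] acting on [L^p]
    ([conditionable_mul_weights]).  For [f] in [L^p], [u (T f)] is
    conditionable, that is, [E|uw| |E(uf)|] is finite, so [E(uf)] vanishes where
    [E|uw|] is infinite.  Take for [f] the conjugate phase of [u] cut off to a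
    set of finite measure in the sub-sigma-algebra: then [E(uf)] is [E|u|] on
    this set, so [u] itself vanishes there where [E|uw|] is infinite.  Then so
    does [uw], and the points where [E|uw|] is infinite form a null set. *)

(** * Conditional expectation of nonnegative functions *)

Section SubSigmaAlgebra.
Set Implicit Arguments.
Unset Strict Implicit.
Unset Printing Implicit Defensive.
Context {d : measure_display} {X : measurableType d} {R : realType}
  (mu : {measure set X -> \bar R}) (G : set (set X))
  (G_sigma : sigma_algebra [set: X] G) (G_sub : G `<=` measurable).
Local Open Scope ereal_scope.
Local Notation GT := (g_sigma_algebraType G).

Lemma measurable_subP (A : set X) : measurable (A : set GT) <-> G A.
Proof. by rewrite measurable_g_measurableTypeE. Qed.

Lemma sub_measurable (A : set X) : measurable (A : set GT) -> measurable A.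
Proof. by move=> /measurable_subP/G_sub. Qed.

Lemma sub_measurable_fun d' (Y : measurableType d') (f : X -> Y) :
  measurable_fun [set: GT] (f : GT -> Y) -> measurable_fun [set: X] f.
Proof. by move=> mf _ B mB; apply: sub_measurable; exact: mf. Qed.

(** If [g' < g] on a set of positive measure, then for some [n], [m] and some
    piece of finite measure the set where [g' <= n] and [g' + 1/(m+1) <= g] is
    not null; there the integral of [g'] is finite and smaller than that of
    [g]. *)
Lemma ae_le_of_le_integral
    (GF : sigma_finite [set: GT] (mu : set GT -> \bar R)) (g g' : X -> \bar R) :
  measurable_fun [set: GT] (g : GT -> \bar R) ->
  measurable_fun [set: GT] (g' : GT -> \bar R) ->
  (forall x, 0 <= g x) -> (forall x, 0 <= g' x) ->
  (forall A, G A -> \int[mu]_(x in A) g x <= \int[mu]_(x in A) g' x) ->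
  {ae mu, forall x, g x <= g' x}.
Proof.
move=> mg mg' g0 g'0 gg'.
case: GF => F FT mF.
pose B i n m : set X := F i `&` [set x | g' x <= n%:R%:E] `&`
  [set x | g' x + (m.+1%:R^-1)%:E <= g x].
have mB i n m : measurable (B i n m : set GT).
  apply: measurableI; first apply: measurableI; first by have [] := mF i.
  - rewrite -[X in measurable X]setTI; apply: emeasurable_fun_infty_c => //.
  - rewrite -[X in measurable X]setTI; apply: measurable_lee => //.
    exact: emeasurable_funD.
have muB i n m : mu (B i n m) = 0.
  have mBX := sub_measurable (mB i n m).
  have GB : G (B i n m) by apply/measurable_subP.
  have mg'B : measurable_fun (B i n m) g'.
    by apply: measurable_funTS; exact: sub_measurable_fun.
  have fin : \int[mu]_(x in B i n m) g' x < +oo.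
    apply: (@le_lt_trans _ _ (\int[mu]_(x in B i n m) n%:R%:E)).
      by apply: ge0_le_integral => // x [[]].
    rewrite integral_cst//; apply: lte_mul_pinfty => //.
    have [mFi] := mF i; apply: le_lt_trans; apply: le_measure; rewrite ?inE//.
    - exact: sub_measurable.
    - by move=> x [[]].
  have := gg' _ GB.
  have : \int[mu]_(x in B i n m) (g' x + (m.+1%:R^-1)%:E) <=
         \int[mu]_(x in B i n m) g x.
    apply: ge0_le_integral => //.
    - by move=> x _; rewrite adde_ge0// lee_fin.
    - by apply: emeasurable_funD.
    - by apply: measurable_funTS; exact: sub_measurable_fun.
    - by move=> x [].
  move=> /le_trans/[apply].
  rewrite ge0_integralD// integral_cst//.
  rewrite -[leRHS]adde0 leeD2lE ?ge0_fin_numE ?integral_ge0//.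
  by rewrite pmule_rle0// => mB0; apply/eqP; rewrite eq_le mB0/=.
have : {ae mu, forall x, forall i n m, ~ B i n m x}.
  apply: ae_foralln => i; apply: ae_foralln => n; apply: ae_foralln => m.
  exists (B i n m); split; [exact: sub_measurable|exact: muB|].
  by move=> x /contrapT.
apply: filterS => x nB; rewrite leNgt; apply/negP => g'g.
have [i _ Fi] : (\bigcup_i F i) x by rewrite -FT.
have g'fin : g' x \is a fin_num.
  by rewrite ge0_fin_numE//; exact: lt_le_trans g'g (leey _).
pose n := Num.bound (fine (g' x)).
have [m hm] : exists m, g' x + (m.+1%:R^-1)%:E <= g x.
  rewrite -(fineK g'fin).
  case: (g x) g'g => [r| |];
    [|by move=> _; exists 0%N; exact: leey|by rewrite ltNge leNye].
  rewrite -(fineK g'fin) lte_fin -subr_gt0 => rg.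
  exists (Num.bound ((r - fine (g' x))^-1)).
  rewrite -EFinD lee_fin addrC -lerBrDr invf_ple ?posrE//.
  apply: (@le_trans _ _ (Num.bound ((r - fine (g' x))^-1))%:R).
    by apply/ltW/archi_boundP; rewrite invr_ge0 ltW.
  by rewrite ler_nat.
apply: (nB i n m); split => //; split => //=.
rewrite -(fineK g'fin) lee_fin ltW// archi_boundP//.
exact: fine_ge0.
Qed.

Lemma is_condexp_le_ae
    (GF : sigma_finite [set: GT] (mu : set GT -> \bar R))
    (f f' g g' : X -> \bar R) :
  measurable_fun [set: X] f -> measurable_fun [set: X] f' ->
  (forall x, 0 <= f x) -> (forall x, 0 <= f' x) ->
  is_condexp mu G f g -> is_condexp mu G f' g' ->
  {ae mu, forall x, f x <= f' x} -> {ae mu, forall x, g x <= g' x}.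
Proof.
move=> mf mf' f0 f'0 [g0 mg gf] [g'0 mg' gf'] ff'.
apply: ae_le_of_le_integral => // A GA; rewrite gf// gf'//.
apply: ae_ge0_le_integral => //; first exact: G_sub.
- exact: measurable_funTS.
- exact: measurable_funTS.
- by apply: filterS ff' => x.
Qed.

Lemma is_condexp_unique
    (GF : sigma_finite [set: GT] (mu : set GT -> \bar R))
    (f g g' : X -> \bar R) :
  is_condexp mu G f g -> is_condexp mu G f g' -> {ae mu, forall x, g x = g' x}.
Proof.
move=> [g0 mg gf] [g'0 mg' gf'].
have gg' : {ae mu, forall x, g x <= g' x}.
  by apply: ae_le_of_le_integral => // A GA; rewrite gf// gf'.
have g'g : {ae mu, forall x, g' x <= g x}.
  by apply: ae_le_of_le_integral => // A GA; rewrite gf// gf'.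
by apply: filterS2 gg' g'g => x le1 le2; apply/eqP; rewrite eq_le le1.
Qed.

Lemma is_condexpD (f f' g g' : X -> \bar R) :
  measurable_fun [set: X] f -> measurable_fun [set: X] f' ->
  (forall x, 0 <= f x) -> (forall x, 0 <= f' x) ->
  is_condexp mu G f g -> is_condexp mu G f' g' ->
  is_condexp mu G (f \+ f') (g \+ g').
Proof.
move=> mf mf' f0 f'0 [g0 mg gf] [g'0 mg' gf']; split.
- by move=> x; rewrite adde_ge0.
- exact: emeasurable_funD.
- move=> A GA; have mA := G_sub GA.
  rewrite !ge0_integralD ?gf ?gf'//; apply: measurable_funTS => //;
    exact: sub_measurable_fun.
Qed.

Import HBNNSimple.

(** The pull-out rule is reduced by this formula to the defining property of
    the conditional expectation: when [A] is in [G], each integral on the right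
    is over a set of [G]. *)
Lemma integral_nnsfun_mul (h : {nnsfun GT >-> R}) (f : X -> \bar R)
    (A : set X) :
  measurable_fun [set: X] f -> (forall x, 0 <= f x) -> measurable A ->
  \int[mu]_(x in A) ((h x)%:E * f x) =
  \sum_(y \in range h) (y%:E * \int[mu]_(x in A `&` h @^-1` [set y]) f x).
Proof.
move=> mf f0 mA.
have mh y : measurable (h @^-1` [set y] : set X).
  apply: sub_measurable; exact: measurable_sfunP.
have hy0 y x : 0 <= y%:E * (\1_(h @^-1` [set y]) x)%:E.
  exact: nnfun_muleindic_ge0.
have mind y :
  measurable_fun A (fun x => (\1_(h @^-1` [set y] : set X) x)%:E * f x).
  apply: emeasurable_funM; last exact: measurable_funTS.
  by apply/measurable_EFinP/measurable_funTS; exact: measurable_indic.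
under eq_integral => x _.
  rewrite fimfunE -fsumEFin// ge0_mule_fsuml; last first.
    by move=> y; rewrite EFinM.
  over.
rewrite ge0_integral_fsum//; last 2 first.
- move=> y; under eq_fun do rewrite EFinM -muleA.
  by apply: emeasurable_funM => //; exact: measurable_cst.
- by move=> y x _; rewrite mule_ge0// EFinM.
apply: eq_fsbigr => y /set_mem yh.
have y0 : (0 <= y)%R by case: yh => x _ <-.
under eq_integral do rewrite EFinM -muleA.
rewrite ge0_integralZl_EFin//; last by move=> x _; rewrite mule_ge0// lee_fin.
congr (_ * _); rewrite integral_mkcondr; apply: eq_integral => x _.
rewrite patchE indicE; case: ifPn => xh.
- by rewrite mul1e.
- by rewrite mul0e.
Qed.

(** For simple [k] this is [integral_nnsfun_mul]; the general case follows by
    monotone convergence on both sides.  The expectation [g] may take the value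
    [+oo], as is needed to study the set where [E|uw|] is infinite. *)
Lemma is_condexpM (k : X -> R) (f g : X -> \bar R) :
  measurable_fun [set: GT] (k : GT -> R) -> (forall x, (0 <= k x)%R) ->
  measurable_fun [set: X] f -> (forall x, 0 <= f x) ->
  is_condexp mu G f g ->
  is_condexp mu G (fun x => (k x)%:E * f x) (fun x => (k x)%:E * g x).
Proof.
move=> mk k0 mf f0 [g0 mg gf]; split.
- by move=> x; rewrite mule_ge0// lee_fin.
- by apply: emeasurable_funM => //; exact/measurable_EFinP.
move=> A GA; have mA := G_sub GA.
have mEk : measurable_fun [set: GT] ((EFin \o k) : GT -> \bar R).
  exact/measurable_EFinP.
pose h := nnsfun_approx measurableT mEk.
have ndh x : nondecreasing_seq (fun n => h n x).
  by move=> m n mn; exact/lefP/nd_nnsfun_approx.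
have cvgh x : (h n x)%:E @[n --> \oo] --> (k x)%:E.
  by apply: cvg_nnsfun_approx => // y _; rewrite lee_fin.
have hk n x : (h n x)%:E <= (k x)%:E.
  have nd : nondecreasing_seq (fun n => (h n x)%:E).
    by move=> i j ij; rewrite lee_fin ndh.
  rewrite (cvg_unique _ (cvgh x) (ereal_nondecreasing_cvgn nd))//.
  by apply: ereal_sup_ubound; exists n.
have lim_int (e : X -> \bar R) : measurable_fun [set: X] e ->
    (forall x, 0 <= e x) -> \int[mu]_(x in A) ((k x)%:E * e x) =
    limn (fun n => \int[mu]_(x in A) ((h n x)%:E * e x)).
  move=> me e0; rewrite -monotone_convergence//; last 3 first.
  - move=> n; apply: emeasurable_funM; last exact: measurable_funTS.
    apply/measurable_EFinP/measurable_funTS; apply: sub_measurable_fun.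
    exact: measurable_funP.
  - by move=> n x _; rewrite mule_ge0// lee_fin.
  - by move=> x _ m n mn; rewrite lee_wpmul2r// lee_fin ndh.
  apply: eq_integral => x _; apply/esym/cvg_lim => //.
  (* Where [e x = +oo] multiplication is discontinuous at 0, but there the
     simple functions below [k] vanish too. *)
  have [kx0|kx0] := eqVneq (k x) 0%R.
    rewrite kx0 mul0e; apply: cvg_near_cst; apply: nearW => n.
    suff -> : h n x = 0%R by rewrite mul0e.
    by apply/eqP; rewrite eq_le fun_ge0 andbT -lee_fin -kx0 hk.
  apply: cvgeM => //; last exact: cvg_cst.
  have [ex|ex] := boolP (e x \is a fin_num); first exact: mule_def_fin.
  by apply: mule_def_neq0_infty => //; rewrite eqe.
have me : measurable_fun [set: X] g by exact: sub_measurable_fun.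
rewrite !lim_int//; congr (limn _); apply/funext => n.
rewrite !integral_nnsfun_mul//; apply: eq_fsbigr => y _; congr (_ * _).
apply/gf/measurable_subP/measurableI; last exact: measurable_sfunP.
exact/measurable_subP.
Qed.

(** The conditional expectations of the restrictions of [f] to the
    disjointified cover are summed.  The pieces are not taken from [G], so that
    level sets of [f] can be used. *)
Lemma ex_is_condexp_cover (f : X -> \bar R) (F : nat -> set X) :
  measurable_fun [set: X] f -> (forall x, 0 <= f x) ->
  (forall n, measurable (F n)) -> \bigcup_n F n = [set: X] ->
  (forall n A, measurable A -> A `<=` F n ->
    exists g, is_condexp mu G (f \_ A) g) ->
  exists g, is_condexp mu G f g.
Proof.
move=> mf f0 mF FT ex.
have mD n : measurable (seqDU F n).
  by apply: measurableD => //; exact: bigsetU_measurable.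
have [g gP] := choice (fun n => ex n _ (mD n) (@subDsetl _ _ _)).
have g0 n x : 0 <= g n x by have [] := gP n.
have mg n : measurable_fun [set: GT] (g n : GT -> \bar R) by have [] := gP n.
exists (fun x => \sum_(n <oo) g n x); split.
- by move=> x; exact: nneseries_ge0.
- exact: (ge0_emeasurable_sum (P := xpredT)).
move=> A GA; have mA := G_sub GA.
rewrite integral_nneseries//; last first.
  by move=> n; apply: measurable_funTS; exact: sub_measurable_fun.
have -> : A = \bigcup_n (A `&` seqDU F n).
  by rewrite -setI_bigcupr -seqDU_bigcup_eq FT setIT.
rewrite ge0_integral_bigcup//.
- apply: eq_eseriesr => n _; rewrite -setI_bigcupr -seqDU_bigcup_eq FT setIT.
  have [_ _ ->//] := gP n.
  by rewrite integral_mkcondr.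
- by move=> n; exact: measurableI.
- exact: measurable_funTS.
- exact/trivIset_setIl/trivIset_seqDU.
Qed.

(** Radon-Nikodym on the space [X] with the sigma-algebra [G], applied to the
    finite measure with density [f] and to the restriction of [mu]. *)
Lemma ex_is_condexp_integrable (f : X -> \bar R)
    (GF : sigma_finite [set: GT] (mu : set GT -> \bar R)) :
  measurable_fun [set: X] f -> (forall x, 0 <= f x) -> \int[mu]_x f x < +oo ->
  exists g, is_condexp mu G f g.
Proof.
move=> mf f0 intf.
pose muG := (mu : set GT -> \bar R).
have muG0 : muG set0 = 0 by exact: measure0.
have muG_ge0 A : 0 <= muG A by exact: measure_ge0.
have muG_sigma : semi_sigma_additive muG.
  move=> F mF tF mUF; apply: measure_semi_sigma_additive => //.
  - by move=> i; apply: sub_measurable; exact: mF.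
  - exact: sub_measurable.
pose mmuG := isMeasure.Build _ _ _ muG muG0 muG_ge0 muG_sigma.
pose mu1 : {measure set GT -> \bar R} := HB.pack muG mmuG.
pose smuG := Measure_isSigmaFinite.Build _ _ _ mu1 GF.
pose mu' : {sigma_finite_measure set GT -> \bar R} :=
  HB.pack (Measure.sort mu1) smuG.
pose nu := (fun A : set GT => \int[mu]_(x in A) f x).
have nu0 : nu set0 = 0 by exact: integral_set0.
have nu_ge0 A : 0 <= nu A by exact: integral_ge0.
have nu_sigma : semi_sigma_additive nu.
  move=> F mF tF mUF; apply: semi_sigma_additive_nng_induced => //.
  - by move=> i; apply: sub_measurable; exact: mF.
  - exact: sub_measurable.
have nu_fin : fin_num_fun nu.
  move=> A /sub_measurable mA; rewrite ge0_fin_numE//.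
  by apply: le_lt_trans intf; exact: ge0_subset_integral.
pose mnu := isMeasure.Build _ _ _ nu nu0 nu_ge0 nu_sigma.
pose nu1 : {measure set GT -> \bar R} := HB.pack nu mnu.
pose fnu := Measure_isFinite.Build _ _ _ nu1 nu_fin.
pose nu' : {finite_measure set GT -> \bar R} := HB.pack (Measure.sort nu1) fnu.
have dom : nu' `<< mu'.
  apply/null_content_dominatesP => A /sub_measurable mA muA0.
  by apply: null_set_integral => //; exact: measurable_funTS.
have [g [g0 _ /measurable_int mg nug]] := radon_nikodym_sigma_finite dom.
exists g; split => // A GA.
have mA : measurable (A : set GT) by apply/measurable_subP.
rewrite -[RHS]/(nu' A) nug//.
have mid : measurable_fun [set: X] (id : X -> GT).
  by move=> _ B mB; rewrite setTI; exact: sub_measurable.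
(* The restriction of [mu] to [G] is its image under the identity map. *)
have := ge0_integral_pushforward mid mu mA (measurable_funTS mg)
  (fun x _ => g0 x).
move=> /= <-; reflexivity.
Qed.

(** The cover by the sets [f <= n], refined by a cover by sets of finite
    measure, has pieces on which [f] is integrable. *)
Lemma ex_is_condexp (f : X -> R)
    (GF : sigma_finite [set: GT] (mu : set GT -> \bar R)) :
  measurable_fun [set: X] f -> (forall x, (0 <= f x)%R) ->
  exists g, is_condexp mu G (EFin \o f) g.
Proof.
move=> mf f0.
have mEf : measurable_fun [set: X] (EFin \o f) by exact/measurable_EFinP.
have Ef0 A x : 0 <= ((EFin \o f) \_ A) x.
  by apply: erestrict_ge0 => y _; rewrite lee_fin.
have mEfA A : measurable A -> measurable_fun [set: X] ((EFin \o f) \_ A).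
  move=> mA; apply/(measurable_restrictT _ mA); exact: measurable_funTS.
apply: (@ex_is_condexp_cover _ (fun n => [set x | (f x <= n%:R)%R])) => //.
- move=> n; rewrite -[X in measurable X]setTI.
  exact: measurable_fun_ler.
- apply/seteqP; split => // x _; exists (Num.bound (f x)) => //=.
  by rewrite ltW// archi_boundP.
move=> n A mA fn.
have [F FT mF] := GF.
apply: (@ex_is_condexp_cover _ F) => //.
- exact: mEfA.
- by move=> i; have [/sub_measurable] := mF i.
move=> i B mB BF.
apply: ex_is_condexp_integrable => //.
- apply/(measurable_restrictT _ mB); apply: measurable_funTS; exact: mEfA.
- by move=> x; apply: erestrict_ge0.
rewrite -integral_mkcond.
have muB : mu B < +oo.
  have [/sub_measurable mFi] := mF i; apply: le_lt_trans.
  by apply: le_measure; rewrite ?inE.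
apply: (@le_lt_trans _ _ (\int[mu]_(x in B) n%:R%:E)).
  apply: ge0_le_integral => //.
  - apply: measurable_funTS; exact: mEfA.
  - by move=> x _; rewrite patchE; case: ifPn => [/set_mem/fn|_];
      rewrite lee_fin.
by rewrite integral_cst//; exact: lte_mul_pinfty.
Qed.

Lemma ge0_condexpP (f : X -> R)
    (GF : sigma_finite [set: GT] (mu : set GT -> \bar R)) :
  measurable_fun [set: X] f -> (forall x, (0 <= f x)%R) ->
  is_condexp mu G (EFin \o f) (ge0_condexp mu G (EFin \o f)).
Proof.
move=> mf f0; have [g gP] := ex_is_condexp GF mf f0.
exact: (@xgetI _ (cst 0) [set g | is_condexp mu G (EFin \o f) g] g gP).
Qed.

End SubSigmaAlgebra.

(** * Measurability of complex functions *)

Import ComplexField.Normc.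

Section ComplexAlgebra.
Context {R : realType}.
Implicit Types y z : R[i].

Lemma Re_mulc y z :
  complex.Re (y * z) =
  complex.Re y * complex.Re z - complex.Im y * complex.Im z.
Proof. by case: y z => [a b] [c e]. Qed.

Lemma Im_mulc y z :
  complex.Im (y * z) =
  complex.Re y * complex.Im z + complex.Im y * complex.Re z.
Proof. by case: y z => [a b] [c e]. Qed.

Lemma normc_sqrtE z :
  normc z = Num.sqrt (complex.Re z ^+ 2 + complex.Im z ^+ 2).
Proof. by case: z. Qed.

Lemma normc_ge0 z : 0 <= normc z.
Proof. by rewrite normc_sqrtE sqrtr_ge0. Qed.

Lemma normr_Re_le z : `|complex.Re z| <= normc z.
Proof. by rewrite normc_sqrtE -sqrtr_sqr ler_wsqrtr// lerDl sqr_ge0. Qed.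

Lemma normr_Im_le z : `|complex.Im z| <= normc z.
Proof. by rewrite normc_sqrtE -sqrtr_sqr ler_wsqrtr// lerDr sqr_ge0. Qed.

Lemma normc_real (a : R) : normc a%:C%C = `|a|.
Proof. by rewrite normc_sqrtE/= expr0n addr0 sqrtr_sqr. Qed.

Lemma normcX z n : normc (z ^+ n) = normc z ^+ n.
Proof.
elim: n => [|n IH]; first by rewrite !expr0 normc1.
by rewrite !exprS normcM IH.
Qed.

End ComplexAlgebra.

Section ComplexMeasurable.
Set Implicit Arguments.
Unset Strict Implicit.
Unset Printing Implicit Defensive.
Context {d : measure_display} {X : measurableType d} {R : realType}.
Implicit Types f g : X -> R[i].

Lemma measurable_powR_comp (f : X -> R) (r : R) :
  measurable_fun [set: X] f -> measurable_fun [set: X] (fun x => f x `^ r).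
Proof. move=> mf; exact: (measurableT_comp (measurable_powR r) mf). Qed.

Lemma L0_mul f g : L0 f -> L0 g -> L0 (fun x => f x * g x).
Proof.
move=> [mRf mIf] [mRg mIg]; split.
- under eq_fun do rewrite Re_mulc.
  by apply: measurable_funB; exact: measurable_funM.
- under eq_fun do rewrite Im_mulc.
  by apply: measurable_funD; exact: measurable_funM.
Qed.

Lemma L0_real (f : X -> R) : measurable_fun [set: X] f ->
  L0 (fun x => (f x)%:C%C).
Proof. by move=> mf; split => //=; exact: measurable_cst. Qed.

Lemma L0_exp f n : L0 f -> L0 (fun x => f x ^+ n).
Proof.
move=> mf; elim: n => [|n IH]; first by split; exact: measurable_cst.
by under eq_fun do rewrite exprS; exact: L0_mul.
Qed.

Lemma L0_inv f : L0 f -> L0 (fun x => (f x)^-1).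
Proof.
move=> [mRf mIf].
pose n2 x := complex.Re (f x) ^+ 2 + complex.Im (f x) ^+ 2.
have n2_ge0 x : 0 <= n2 x by rewrite addr_ge0// sqr_ge0.
have mn2 : measurable_fun [set: X] (fun x => (n2 x)^-1).
  under eq_fun do rewrite -powR_inv1//.
  apply: measurable_powR_comp.
  by apply: measurable_funD; exact: measurable_funX.
have fV x : (f x)^-1 =
    (complex.Re (f x) * (n2 x)^-1 +i* - (complex.Im (f x) * (n2 x)^-1))%C.
  by rewrite /n2; case: (f x).
split; under eq_fun do rewrite fV.
- exact: measurable_funM.
- exact/measurable_funN/measurable_funM.
Qed.

Lemma measurable_cmod f : L0 f -> measurable_fun [set: X] (cmod f).
Proof.
move=> [mRf mIf]; rewrite /cmod.
under eq_fun do rewrite normc_sqrtE -powR12_sqrt ?addr_ge0 ?sqr_ge0//.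
by apply: measurable_powR_comp; apply: measurable_funD; exact: measurable_funX.
Qed.

End ComplexMeasurable.

(** * Conditional expectation of real and complex functions *)

Section SignedCondexp.
Set Implicit Arguments.
Unset Strict Implicit.
Unset Printing Implicit Defensive.
Context {d : measure_display} {X : measurableType d} {R : realType}
  (mu : {measure set X -> \bar R}) (G : set (set X))
  (G_sigma : sigma_algebra [set: X] G) (G_sub : G `<=` measurable)
  (GF : sigma_finite [set: g_sigma_algebraType G]
          (mu : set (g_sigma_algebraType G) -> \bar R)).
Local Notation GT := (g_sigma_algebraType G).

(** Conditional expectations with finite values, so that they can be
    subtracted. *)
Definition nncondexp (a A : X -> R) :=
  [/\ measurable_fun [set: X] a, forall x, 0 <= a x &
      is_condexp mu G (EFin \o a) (EFin \o A)].

(** An arbitrary difference of nonnegative functions is allowed, instead of the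
    positive and negative parts: this is stable under sums and products by
    construction, and by [rcondexp_unique] the choice does not matter. *)
Definition rcondexp (f g : X -> R) :=
  exists a b A B, [/\ nncondexp a A, nncondexp b B, f = a \- b & g = A \- B].

Definition ccondexp (f g : X -> R[i]) :=
  rcondexp (fun x => complex.Re (f x)) (fun x => complex.Re (g x)) /\
  rcondexp (fun x => complex.Im (f x)) (fun x => complex.Im (g x)).

Lemma nncondexp_ge0 a A x : nncondexp a A -> 0 <= A x.
Proof. by case=> _ _ [/(_ x)]; rewrite lee_fin. Qed.

Lemma nncondexp_measurable a A : nncondexp a A ->
  measurable_fun [set: GT] (A : GT -> R).
Proof. by case=> _ _ [_ /measurable_EFinP]. Qed.

Lemma nncondexpD a b A B : nncondexp a A -> nncondexp b B ->
  nncondexp (a \+ b) (A \+ B).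
Proof.
move=> [ma a0 aA] [mb b0 bB]; split; first exact: measurable_funD.
- by move=> x; rewrite addr_ge0.
- by apply: (is_condexpD G_sigma G_sub _ _ _ _ aA bB) => //;
    exact/measurable_EFinP.
Qed.

Lemma nncondexpM k a A : measurable_fun [set: GT] (k : GT -> R) ->
  (forall x, 0 <= k x) -> nncondexp a A -> nncondexp (k \* a) (k \* A).
Proof.
move=> mk k0 [ma a0 aA]; split.
- by apply: measurable_funM => //; apply: (sub_measurable_fun G_sigma G_sub).
- by move=> x; rewrite mulr_ge0.
- by apply: (is_condexpM G_sigma G_sub _ _ _ _ aA) => //;
    exact/measurable_EFinP.
Qed.

Lemma nncondexp_rcondexp a A : nncondexp a A -> rcondexp a A.
Proof.
move=> aA; exists a, (cst 0), A, (cst 0); split => //;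
  try by apply/funext => x /=; rewrite subr0.
split; [exact: measurable_cst|by []|split => //].
exact/measurable_EFinP/measurable_cst.
Qed.

(** If [a - b = a' - b'] then [a + b' = a' + b], and uniqueness for nonnegative
    functions applies to the latter. *)
Lemma rcondexp_unique f g g' : rcondexp f g -> rcondexp f g' ->
  {ae mu, forall x, g x = g' x}.
Proof.
move=> [a [b [A [B [aA bB -> ->]]]]] [a' [b' [A' [B' [aA' bB' eab ->]]]]].
have eadd : a \+ b' = a' \+ b.
  apply/funext => x /=; have := congr1 (@^~ x) eab => /=; lra.
have h1 := nncondexpD aA bB'.
have h2 := nncondexpD aA' bB.
rewrite -eadd in h2.
have [[_ _ c1] [_ _ c2]] := (h1, h2).
apply: filterS (is_condexp_unique G_sigma G_sub GF c1 c2) => x /= [] e.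
lra.
Qed.

Lemma rcondexpD f f' g g' : rcondexp f g -> rcondexp f' g' ->
  rcondexp (f \+ f') (g \+ g').
Proof.
move=> [a [b [A [B [aA bB -> ->]]]]] [a' [b' [A' [B' [aA' bB' -> ->]]]]].
exists (a \+ a'), (b \+ b'), (A \+ A'), (B \+ B'); split.
- exact: nncondexpD.
- exact: nncondexpD.
- by apply/funext => x /=; lra.
- by apply/funext => x /=; lra.
Qed.

Lemma rcondexpN f g : rcondexp f g -> rcondexp (\- f) (\- g).
Proof.
move=> [a [b [A [B [aA bB -> ->]]]]]; exists b, a, B, A; split => //;
  by apply/funext => x /=; lra.
Qed.

(** With [k = k^+ - k^-], the product [k (a - b)] is the difference of
    [k^+ a + k^- b] and [k^+ b + k^- a]. *)
Lemma rcondexpM k f g : measurable_fun [set: GT] (k : GT -> R) ->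
  rcondexp f g -> rcondexp (k \* f) (k \* g).
Proof.
move=> mk [a [b [A [B [aA bB -> ->]]]]].
have mp : measurable_fun [set: GT] (k^\+ : GT -> R).
  exact: measurable_funrpos.
have mn : measurable_fun [set: GT] (k^\- : GT -> R).
  exact: measurable_funrneg.
have kE x : k x = k^\+ x - k^\- x by rewrite -{1}(funrposBneg k).
exists (k^\+ \* a \+ k^\- \* b), (k^\+ \* b \+ k^\- \* a),
       (k^\+ \* A \+ k^\- \* B), (k^\+ \* B \+ k^\- \* A); split.
- by apply: nncondexpD; apply: nncondexpM => // x;
    rewrite ?funrpos_ge0 ?funrneg_ge0.
- by apply: nncondexpD; apply: nncondexpM => // x;
    rewrite ?funrpos_ge0 ?funrneg_ge0.
- by apply/funext => x /=; rewrite kE; ring.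
- by apply/funext => x /=; rewrite kE; ring.
Qed.

Lemma rcondexp_measurable f g : rcondexp f g ->
  measurable_fun [set: GT] (g : GT -> R).
Proof.
move=> [a [b [A [B [aA bB _ ->]]]]].
by apply: measurable_funB; apply: nncondexp_measurable; eassumption.
Qed.

Lemma ccondexp_unique f g g' : ccondexp f g -> ccondexp f g' ->
  {ae mu, forall x, g x = g' x}.
Proof.
move=> [Rfg Ifg] [Rfg' Ifg'].
apply: filterS2 (rcondexp_unique Rfg Rfg') (rcondexp_unique Ifg Ifg').
by move=> x; case: (g x) (g' x) => [a b] [a' b'] /= -> ->.
Qed.

Lemma ccondexpM k f g : L0 (k : GT -> R[i]) -> ccondexp f g ->
  ccondexp (fun x => k x * f x) (fun x => k x * g x).
Proof.
move=> [mRk mIk] [Rfg Ifg]; split.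
- under eq_fun do rewrite Re_mulc.
  under [X in rcondexp _ X]eq_fun do rewrite Re_mulc.
  by apply: rcondexpD; [|apply: rcondexpN]; exact: rcondexpM.
- under eq_fun do rewrite Im_mulc.
  under [X in rcondexp _ X]eq_fun do rewrite Im_mulc.
  by apply: rcondexpD; exact: rcondexpM.
Qed.

Lemma ccondexp_measurable f g : ccondexp f g -> L0 (g : GT -> R[i]).
Proof. by move=> [/rcondexp_measurable ? /rcondexp_measurable ?]. Qed.

(** Domination by a function with finite conditional expectation makes the
    conditional expectation of [a] almost everywhere finite, so that taking its
    real values changes no integral. *)
Lemma nncondexp_fine (a e : X -> R) :
  measurable_fun [set: X] a -> (forall x, 0 <= a x) ->
  measurable_fun [set: X] e -> (forall x, a x <= e x) ->
  {ae mu, forall x, (ge0_condexp mu G (EFin \o e) x < +oo)%E} ->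
  nncondexp a (fine \o ge0_condexp mu G (EFin \o a)).
Proof.
move=> ma a0 me ae fin_e.
have e0 x : 0 <= e x by apply: le_trans (ae x).
have aP := ge0_condexpP G_sigma G_sub GF ma a0.
have eP := ge0_condexpP G_sigma G_sub GF me e0.
have fin_a : {ae mu, forall x, (ge0_condexp mu G (EFin \o a) x < +oo)%E}.
  have mEa : measurable_fun [set: X] (EFin \o a) by exact/measurable_EFinP.
  have mEe : measurable_fun [set: X] (EFin \o e) by exact/measurable_EFinP.
  have Ea0 x : (0 <= (EFin \o a) x)%E by rewrite lee_fin.
  have Ee0 x : (0 <= (EFin \o e) x)%E by rewrite lee_fin.
  have le_ae : {ae mu, forall x, ((EFin \o a) x <= (EFin \o e) x)%E}.
    by apply: aeW => x; rewrite lee_fin.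
  have := is_condexp_le_ae G_sigma G_sub GF mEa mEe Ea0 Ee0 aP eP le_ae.
  by move=> h; apply: filterS2 h fin_e => x; exact: le_lt_trans.
have [p0 mp intp] := aP.
split => //; split.
- by move=> x; rewrite lee_fin fine_ge0.
- by apply/measurable_EFinP; exact: measurableT_comp.
- move=> A GA; rewrite -intp//; have mA := G_sub GA.
  have mpX := sub_measurable_fun G_sigma G_sub mp.
  apply: ge0_ae_eq_integral => //.
  + apply: measurable_funTS; apply/measurable_EFinP.
    by apply: measurableT_comp.
  + exact: measurable_funTS.
  + by move=> x _; rewrite lee_fin fine_ge0.
  + by apply: filterS fin_a => x hx _ /=; rewrite fineK// ge0_fin_numE.
Qed.

Lemma re_condexpP (f e : X -> R) :
  measurable_fun [set: X] f ->
  measurable_fun [set: X] e -> (forall x, `|f x| <= e x) ->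
  {ae mu, forall x, (ge0_condexp mu G (EFin \o e) x < +oo)%E} ->
  rcondexp f (re_condexp mu G f).
Proof.
move=> mf me fe fin_e.
have posE : (EFin \o f)^\+%E = EFin \o f^\+.
  by apply/funext => x; rewrite funeposE /= /funrpos EFin_max.
have negE : (EFin \o f)^\-%E = EFin \o f^\-.
  by apply/funext => x; rewrite funenegE /= /funrneg EFin_max.
exists f^\+, f^\-, (fine \o ge0_condexp mu G (EFin \o f^\+)),
  (fine \o ge0_condexp mu G (EFin \o f^\-)); split.
- apply: (@nncondexp_fine _ e) => //; first exact: measurable_funrpos.
  move=> x; apply: le_trans (fe x).
  by rewrite /funrpos ge_max ler_norm normr_ge0.
- apply: (@nncondexp_fine _ e) => //; first exact: measurable_funrneg.
  move=> x; apply: le_trans (fe x).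
  by rewrite /funrneg ge_max normr_ge0 -normrN ler_norm.
- by rewrite -{1}(funrposBneg f).
- by apply/funext => x; rewrite /re_condexp posE negE.
Qed.

(** Both parts are dominated by the modulus, whose conditional expectation is
    finite by conditionability. *)
Lemma condexpP (f : X -> R[i]) : L0 f -> conditionable mu G f ->
  ccondexp f (condexp mu G f).
Proof.
move=> mf cf; have mcf := measurable_cmod mf; have [mRf mIf] := mf; split.
- by apply: (re_condexpP _ mcf _ cf) => // x; exact: normr_Re_le.
- by apply: (re_condexpP _ mcf _ cf) => // x; exact: normr_Im_le.
Qed.

End SignedCondexp.

(** * Membership in L^p *)

Lemma ge0_integral_eq0P (d : measure_display) (X : measurableType d)
    (R : realType) (mu : {measure set X -> \bar R}) (B : set X)
    (f : X -> \bar R) :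
  measurable B -> measurable_fun [set: X] f -> (forall x, (0 <= f x)%E) ->
  (\int[mu]_(x in B) f x = 0)%E <-> {ae mu, forall x, B x -> f x = 0%E}.
Proof.
move=> mB mf f0; have mfB : measurable_fun B f by exact: measurable_funTS.
have -> : (\int[mu]_(x in B) f x = \int[mu]_(x in B) `|f x|)%E.
  by apply: eq_integral => x _; rewrite gee0_abs.
exact: ae_eq_integral_abs.
Qed.

Section LpMembership.
Set Implicit Arguments.
Unset Strict Implicit.
Unset Printing Implicit Defensive.
Context {d : measure_display} {X : measurableType d} {R : realType}
  (mu : {measure set X -> \bar R}) (p : \bar R) (p_ge1 : (1 <= p)%E).

Lemma cmod_ge0 (f : X -> R[i]) x : 0 <= cmod f x.
Proof. exact: normc_ge0. Qed.

Lemma Lp_dominated (C : R) (f g : X -> R[i]) : Lp mu p f -> L0 g -> 0 <= C ->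
  {ae mu, forall x, cmod g x <= C * cmod f x} -> Lp mu p g.
Proof.
move=> [mf normf] mg C0 gf; split => //; move: normf.
have mcf := measurable_cmod mf; have mcg := measurable_cmod mg.
rewrite /= /cLnorm; case: p p_ge1 => [r| |//].
- rewrite lee_fin => r1 normf.
  have r0 : r != 0 by rewrite gt_eqF// (lt_le_trans ltr01).
  have r_ge0 : 0 <= r by rewrite (le_trans ler01).
  have intf : (\int[mu]_x (`|(EFin \o cmod f) x| `^ r) < +oo)%E.
    by rewrite -poweR_Lnorm//; exact: poweR_lty.
  rewrite unlock; apply: poweR_lty.
  have mpow (h : X -> R[i]) : L0 h ->
      measurable_fun [set: X] (fun x => (cmod h x `^ r)%:E).
    by move=> mh; apply/measurable_EFinP/measurable_powR_comp/measurable_cmod.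
  have absE (h : X -> R[i]) x :
      (`|(EFin \o cmod h) x| `^ r = (cmod h x `^ r)%:E)%E.
    by rewrite /= ger0_norm ?cmod_ge0.
  under eq_integral do rewrite absE.
  apply: (@le_lt_trans _ _ (\int[mu]_x ((C `^ r)%:E * (cmod f x `^ r)%:E))%E).
    apply: ae_ge0_le_integral => //.
    + by move=> x _; rewrite lee_fin powR_ge0.
    + exact: mpow.
    + by move=> x _; rewrite mule_ge0// lee_fin powR_ge0.
    + by apply: emeasurable_funM; [exact: measurable_cst|exact: mpow].
    + apply: filterS gf => x le_x _; rewrite -EFinM lee_fin.
      rewrite -powRM ?cmod_ge0//; apply: ge0_ler_powR => //;
        by rewrite nnegrE ?mulr_ge0 ?cmod_ge0.
  rewrite ge0_integralZl_EFin ?powR_ge0//; last 2 first.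
  + by move=> x _; rewrite lee_fin powR_ge0.
  + exact: mpow.
  apply: lte_mul_pinfty; rewrite ?lee_fin ?powR_ge0//.
  by under eq_integral do rewrite -absE.
- move=> _; rewrite unlock; case: ifPn => // mu0 normf.
  have [M supM] : exists M : R,
      (ess_sup mu (abse \o (EFin \o cmod f)) <= M%:E)%E.
    case: (ess_sup _ _) normf => [M _|//|_]; first by exists M.
    by exists 0; exact: leNye.
  apply: (@le_lt_trans _ _ (C * M)%:E); last exact: ltry.
  apply/ess_supP; move/ess_supP : supM => supM.
  apply: filterS2 gf supM => x le_x /=.
  rewrite !lee_fin !ger0_norm ?cmod_ge0// => fM.
  by rewrite (le_trans le_x)// ler_wpM2l.
Qed.

Lemma Lp_indic (A : set X) : measurable A -> (mu A < +oo)%E ->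
  Lp mu p (fun x => (\1_A x)%:C%C).
Proof.
move=> mA muA; split; first exact/L0_real/measurable_indic.
have cmodE : cmod (fun x => (\1_A x : R)%:C%C) = \1_A.
  by apply/funext => x; rewrite /cmod normc_real ger0_norm.
rewrite /= /cLnorm cmodE; case: p p_ge1 => [r| |//].
- rewrite lee_fin => r1; rewrite unlock; apply: poweR_lty.
  have r0 : r != 0 by rewrite gt_eqF// (lt_le_trans ltr01).
  have powE x : (`|(EFin \o \1_A) x| `^ r = (\1_A x)%:E :> \bar R)%E.
    rewrite /= ger0_norm// indicE.
    by case: (_ \in _); rewrite ?powR1 ?powR0.
  by under eq_integral do rewrite powE; rewrite integral_indic// setIT.
- move=> _; rewrite unlock; case: ifPn => // _.
  apply: (@le_lt_trans _ _ 1%E); last exact: ltry.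
  by apply/ess_supP/aeW => x /=; rewrite lee_fin ger0_norm// indicE.
Qed.

End LpMembership.

(** * Weighted conditional expectation operators *)

Section WeightedCondexp.
Set Implicit Arguments.
Unset Strict Implicit.
Unset Printing Implicit Defensive.
Context {d : measure_display} {X : measurableType d} {R : realType}
  (mu : {measure set X -> \bar R}) (G : set (set X))
  (G_sigma : sigma_algebra [set: X] G) (G_sub : G `<=` measurable)
  (GF : sigma_finite [set: g_sigma_algebraType G]
          (mu : set (g_sigma_algebraType G) -> \bar R))
  (p : \bar R) (p_ge1 : (1 <= p)%E) (u w : X -> R[i])
  (T_bounded : bounded_wce mu G p u w).
Local Notation GT := (g_sigma_algebraType G).
Local Notation T := (wce mu G u w).

Let L0u : L0 u. Proof. by case: T_bounded. Qed.

Let L0w : L0 w. Proof. by case: T_bounded. Qed.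

Lemma Lp_wce f : Lp mu p f -> Lp mu p (T f).
Proof. by case: T_bounded => _ _ h _ /h[]. Qed.

Lemma Lp_iter_wce f n : Lp mu p f -> Lp mu p (iter n T f).
Proof. by move=> pf; elim: n => [//|n IH]; exact: Lp_wce. Qed.

Lemma ccondexp_wce f : Lp mu p f ->
  ccondexp mu G (fun x => u x * f x) (condexp mu G (fun x => u x * f x)).
Proof.
move=> pf; case: T_bounded => _ _ /(_ f pf)[cf _] _; case: pf => mf _.
by apply: condexpP => //; exact: L0_mul.
Qed.

Lemma wce_mulG k f : L0 (k : GT -> R[i]) -> Lp mu p f ->
  Lp mu p (fun x => k x * f x) ->
  {ae mu, forall x, T (fun x => k x * f x) x = k x * T f x}.
Proof.
move=> mk pf pkf.
have kf := ccondexpM G_sigma G_sub mk (ccondexp_wce pf).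
have := ccondexp_wce pkf.
have -> : (fun x => u x * (k x * f x)) = (fun x => k x * (u x * f x)).
  by apply/funext => x; rewrite mulrCA.
move=> /(ccondexp_unique G_sigma G_sub GF)/(_ kf); apply: filterS => x e.
rewrite /wce mulrCA -e; congr (_ * condexp _ _ _ _).
by apply/funext => y; rewrite mulrCA.
Qed.

Local Notation uw := (fun x => u x * w x).
Local Notation Euw := (ge0_condexp mu G (EFin \o cmod uw)).

Let L0uw : L0 uw. Proof. exact: L0_mul. Qed.

Let EuwP : is_condexp mu G (EFin \o cmod uw) Euw.
Proof.
apply: ge0_condexpP => //; [exact: measurable_cmod|exact: cmod_ge0].
Qed.

(** The modulus of [u (T f)] is [|E(uf)| |uw|], with conditional expectation
    [|E(uf)| E|uw|]; this is almost everywhere finite because [T f] is in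
    [L^p]. *)
Lemma condexp_eq0_infinite_weight f : Lp mu p f ->
  {ae mu, forall x, Euw x = +oo%E -> condexp mu G (fun x => u x * f x) x = 0}.
Proof.
move=> pf; set v := condexp mu G _.
have mcv : measurable_fun [set: GT] (cmod v : GT -> R).
  exact/measurable_cmod/ccondexp_measurable/ccondexp_wce.
have cond_uTf : conditionable mu G (fun x => u x * T f x).
  by case: T_bounded => _ _ /(_ _ (Lp_wce pf))[].
have L0uTf : L0 (fun x => u x * T f x).
  by apply: L0_mul => //; have [] := Lp_wce pf.
have prod := is_condexpM G_sigma G_sub mcv (cmod_ge0 v) _ _ EuwP.
have EuTf := ge0_condexpP G_sigma G_sub GF (measurable_cmod L0uTf) (cmod_ge0 _).
have uTfE : EFin \o cmod (fun x => u x * T f x) =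
    (fun x => (cmod v x)%:E * (EFin \o cmod uw) x)%E.
  apply/funext => x /=; rewrite -EFinM; congr EFin.
  by rewrite /cmod -normcM /wce -/v; congr normc; ring.
rewrite uTfE in EuTf; rewrite /conditionable uTfE in cond_uTf.
have cuw0 x : (0 <= (EFin \o cmod uw) x)%E by rewrite lee_fin cmod_ge0.
have mcuw : measurable_fun [set: X] (EFin \o cmod uw).
  exact/measurable_EFinP/measurable_cmod.
have := is_condexp_unique G_sigma G_sub GF (prod mcuw cuw0) EuTf.
move=> prodE; apply: filterS2 prodE cond_uTf => x <- fin_x Euwx.
apply: eq0_normc; apply: contrapT => /eqP vx0.
move: fin_x; rewrite Euwx gt0_muley ?ltxx// lte_fin.
by rewrite lt_neqAle eq_sym vx0 cmod_ge0.
Qed.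

(** The conjugate phase of [u], which is bounded by 1, turns [u] into its
    modulus. *)
Lemma ex_Lp_phase (A : set X) : measurable A -> (mu A < +oo)%E ->
  exists2 f, Lp mu p f & forall x, u x * f x = (cmod u x * \1_A x)%:C%C.
Proof.
move=> mA muA.
exists (fun x => (u x)^-1 * (cmod u x * \1_A x)%:C%C); last first.
  move=> x; have [ux0|ux0] := eqVneq (u x) 0; last by rewrite mulVKf.
  by rewrite /cmod ux0 normc0 !mul0r.
apply: (Lp_dominated p_ge1 (Lp_indic p_ge1 mA muA) (C := 1)) => //.
  apply: L0_mul; [exact: L0_inv|apply: L0_real].
  by apply: measurable_funM; [exact: measurable_cmod|exact: measurable_indic].
apply: aeW => x; rewrite mul1r /cmod normcM.
rewrite normcV !normc_real normrM (ger0_norm (normc_ge0 (u x))) mulrA.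
have [->|ux0] := eqVneq (normc (u x)) 0; first by rewrite mulr0 mul0r.
by rewrite mulVf// mul1r.
Qed.

(** On the part [B] of [A] where [E|uw|] is infinite, the phase function gives
    [E(|u| 1_A) = 0], so [u], and with it [uw], vanishes on [B]; since [B] is in
    [G], [E|uw|] vanishes on [B] as well. *)
Lemma infinite_weight_negligible (A : set X) : G A -> (mu A < +oo)%E ->
  {ae mu, forall x, ~ ([set y | Euw y = +oo%E] `&` A) x}.
Proof.
move=> GA muA; have mA := G_sub GA.
have [Euw_ge0 mEuw intEuw] := EuwP.
set B := _ `&` A.
have GB : G B.
  apply/(measurable_subP G_sigma); apply: measurableI; last first.
    exact/(measurable_subP G_sigma).
  rewrite -[X in measurable X]setTI.
  by apply: (mEuw measurableT [set +oo%E]); exact: emeasurable_set1.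
have mB := G_sub GB.
have [f pf ufE] := ex_Lp_phase mA muA.
pose a : X -> R := cmod u \* \1_A.
have a_ge0 x : 0 <= a x by rewrite mulr_ge0// cmod_ge0.
have ma : measurable_fun [set: X] a.
  by apply: measurable_funM; [exact: measurable_cmod|exact: measurable_indic].
have ca : cmod (fun x => u x * f x) = a.
  by apply/funext => x; rewrite /cmod ufE normc_real ger0_norm//; exact: a_ge0.
have cond_uf : conditionable mu G (fun x => u x * f x).
  by case: T_bounded => _ _ /(_ f pf)[].
rewrite /conditionable ca in cond_uf.
pose alpha := fine \o ge0_condexp mu G (EFin \o a).
have aP : nncondexp mu G a alpha.
  by apply: (@nncondexp_fine _ _ _ _ _ _ _ _ _ a).
have alphaE : {ae mu, forall x,
    complex.Re (condexp mu G (fun x => u x * f x) x) = alpha x}.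
  have [+ _] := ccondexp_wce pf.
  have -> : (fun x => complex.Re (u x * f x)) = a.
    by apply/funext => x; rewrite ufE.
  by move=> va; exact: rcondexp_unique va (nncondexp_rcondexp aP).
have malpha : measurable_fun [set: X] (EFin \o alpha).
  apply: (sub_measurable_fun G_sigma G_sub).
  apply/measurable_EFinP; exact: nncondexp_measurable aP.
have inta : (\int[mu]_(x in B) (a x)%:E = 0)%E.
  have [_ _ [_ _ /(_ _ GB)]] := aP.
  rewrite /comp => <-; apply/ge0_integral_eq0P => //.
    by move=> x; rewrite lee_fin (nncondexp_ge0 _ aP).
  apply: filterS2 alphaE (condexp_eq0_infinite_weight pf).
  by move=> x <- v0 [/v0 -> _].
have a0 : {ae mu, forall x, B x -> (a x)%:E = 0%E}.
  apply/ge0_integral_eq0P => //; exact/measurable_EFinP.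
have intuw : (\int[mu]_(x in B) (cmod uw x)%:E = 0)%E.
  apply/ge0_integral_eq0P => //; first exact/measurable_EFinP/measurable_cmod.
    by move=> x; rewrite lee_fin cmod_ge0.
  apply: filterS a0 => x ax0 Bx; have := ax0 Bx; have [_ Ax] := Bx.
  rewrite /a /= indicE mem_set// mulr1 => -[u0].
  by rewrite /cmod normcM -/(cmod u x) u0 mul0r.
have : {ae mu, forall x, B x -> Euw x = 0%E}.
  apply/ge0_integral_eq0P => //.
    exact: (sub_measurable_fun G_sigma G_sub).
  by rewrite intEuw.
by apply: filterS => x Euw0 Bx; move: (Euw0 Bx); case: Bx => ->.
Qed.

Lemma conditionable_mul_weights : conditionable mu G uw.
Proof.
have [F FT mF] := GF.
have : {ae mu, forall x i, ~ ([set y | Euw y = +oo%E] `&` F i) x}.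
  apply: ae_foralln => i; have [mFi muFi] := mF i.
  by apply: infinite_weight_negligible => //; apply/(measurable_subP G_sigma).
apply: filterS => x nF; rewrite ltNge leye_eq; apply/negP => /eqP Euwx.
have [i _ Fi] : (\bigcup_i F i) x by rewrite -FT.
exact: (nF i).
Qed.

Local Notation h := (condexp mu G uw).

Lemma ccondexp_weights : ccondexp mu G uw h.
Proof. by apply: condexpP conditionable_mul_weights. Qed.

(** [E(uf)] is pulled out of [E(uw E(uf))]. *)
Lemma wce_wce f : Lp mu p f -> {ae mu, forall x, T (T f) x = h x * T f x}.
Proof.
move=> pf; have cf := ccondexp_wce pf.
have uTf := ccondexp_wce (Lp_wce pf).
have := ccondexpM G_sigma G_sub (ccondexp_measurable cf) ccondexp_weights.
have -> : (fun x => condexp mu G (fun x => u x * f x) x * (u x * w x)) =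
          (fun x => u x * T f x).
  by apply/funext => x; rewrite /wce; ring.
move=> /(ccondexp_unique G_sigma G_sub GF)/(_ uTf); apply: filterS => x e.
by rewrite {1}/wce -e /wce; ring.
Qed.

Lemma iter_wce f n : Lp mu p f ->
  {ae mu, forall x, iter n.+1 T f x = h x ^+ n * T f x}.
Proof.
move=> pf; elim: n => [|n IH]; first by apply: aeW => x; rewrite mul1r.
have := wce_wce (Lp_iter_wce n pf); apply: filterS2 IH => x e1 e2.
by rewrite exprS -mulrA -e1; exact: e2.
Qed.

End WeightedCondexp.

Theorem theorem2p6 (d : measure_display) (X : measurableType d) (R : realType)
    (mu : {sigma_finite_measure set X -> \bar R})
    (mu_complete : measure_is_complete mu)
    (G : set (set X)) (G_sigma : sigma_algebra [set: X] G)
    (G_sub : G `<=` measurable)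
    (G_sigma_finite : sigma_finite [set: g_sigma_algebraType G]
       (mu : set (g_sigma_algebraType G) -> \bar R))
    (p : \bar R) (p_ge1 : (1 <= p)%E)
    (u w : X -> R[i]) (T_bounded : bounded_wce mu G p u w)
    (Euw_away : exists2 C : R, 0 < C &
       mu [set x | cmod (condexp mu G (fun y => u y * w y)) x <= C] = 0%E)
    (n : nat) :
  Lp_range mu p (iter 2 (wce mu G u w)) =
  Lp_range mu p (iter (n + 2) (wce mu G u w)).
Proof.
pose T := wce mu G u w; pose h := condexp mu G (fun y => u y * w y).
have iterE : forall f m, Lp mu p f ->
    {ae mu, forall x, iter m.+1 T f x = h x ^+ m * T f x}.
  move=> f m pf.
  exact: (iter_wce G_sigma G_sub G_sigma_finite p_ge1 T_bounded m pf).
have mh : L0 (h : g_sigma_algebraType G -> R[i]).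
  apply: ccondexp_measurable.
  exact: (ccondexp_weights G_sigma G_sub G_sigma_finite p_ge1 T_bounded).
have mhX : L0 h.
  by case: mh => ? ?; split; apply: (sub_measurable_fun G_sigma G_sub).
have [C C0 muC] := Euw_away.
have h_gtC : {ae mu, forall x, C < cmod h x}.
  exists [set x | cmod h x <= C]; split => //.
  - rewrite -[X in measurable X]setTI; apply: measurable_fun_ler => //.
    exact: measurable_cmod.
  - by move=> x /= /negP; rewrite -leNgt.
apply/seteqP; split => [_ [f pf <-]|_ [f pf <-]]; last first.
  exists (iter n T f); last by rewrite addnC iterD.
  exact: (Lp_iter_wce T_bounded).
pose k x := (h x ^+ n)^-1.
have mk : L0 (k : g_sigma_algebraType G -> R[i]) by exact/L0_inv/L0_exp.
have pkf : Lp mu p (fun x => k x * f x).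
  apply: (Lp_dominated p_ge1 pf (C := (C ^+ n)^-1)).
  - by apply: L0_mul; [exact/L0_inv/L0_exp|case: pf].
  - by rewrite invr_ge0 exprn_ge0// ltW.
  - apply: filterS h_gtC => x Ch.
    rewrite /cmod normcM; apply: ler_wpM2r; first exact: normc_ge0.
    rewrite /k normcV normcX lef_pV2 ?posrE ?exprn_gt0//.
    + by apply: lerXn2r; rewrite ?nnegrE ?ltW// (lt_trans C0).
    + by rewrite (lt_trans C0).
exists (fun x => k x * f x) => //.
have agree : {ae mu, forall x,
    iter 2 T f x = iter (n + 2) T (fun x => k x * f x) x}.
  have Tkf : {ae mu, forall x, T (fun x => k x * f x) x = k x * T f x}.
    exact: (wce_mulG G_sigma G_sub G_sigma_finite T_bounded).
  have T2f := iterE f 1%N pf; have Tnkf := iterE _ n.+1 pkf.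
  rewrite addn2; near=> x.
  have -> : iter 2 T f x = h x ^+ 1 * T f x by near: x.
  have -> : iter n.+2 T (fun x => k x * f x) x =
    h x ^+ n.+1 * T (fun x => k x * f x) x by near: x.
  have -> : T (fun x => k x * f x) x = k x * T f x by near: x.
  have hx0 : h x != 0.
    have : C < cmod h x by near: x.
    apply: contraTneq; rewrite /cmod => ->.
    by rewrite normc0 -leNgt ltW.
  by rewrite /k expr1 exprS -mulrA mulVKf// expf_neq0.
apply/seteqP; split => y [my ey]; split => //.
- by apply: filterS2 agree ey => x e1 e2 _; exact: etrans e1 (e2 I).
- by apply: filterS2 agree ey => x e1 e2 _; exact: etrans (esym e1) (e2 I).
Unshelve. all: by end_near.
Qed.
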